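(* Let $0 < p < \infty$ and suppose that $(\Omega, \mu)$ is a measure space. If $D = [x_{j}(m_{j});y_{i}(n_{i})]_{s,t}$ is a virtually degenerate simplex in $L_{p}(\Omega, \mu)$, then $\gamma_{p}(D) = 0$; in other words, $$\sum_{1\le j_{1} < j_{2}\le s} m_{j_{1}}m_{j_{2}} \| x_{j_{1}} - x_{j_{2}}\|_{p}^{p} + \sum_{1\le i_{1} < i_{2}\le t} n_{i_{1}}n_{i_{2}} \| y_{i_{1}} - y_{i_{2}}\|_{p}^{p} = \sum_{j=1}^{s}\sum_{i=1}^{t} m_{j}n_{i} \| x_{j} - y_{i} \|_{p}^{p}.$$
   Context: All measures are non-trivial and positive. $L_{p}(\Omega,\mu)$ is real or complex, carries the usual (quasi-)norm $\|f\|_p = (\int_\Omega |f|^p\,d\mu)^{1/p}$, and is assumed to be at least two-dimensional. A signed $(s,t)$-simplex in a set $X$ ($s,t>0$ integers) is a collection of (not necessarily distinct) points $x_{1},\ldots,x_{s},y_{1},\ldots,y_{t}\in X$ together with real numbers $m_{1},\ldots,m_{s},n_{1},\ldots,n_{t}$ satisfying $m_{1}+\cdots+m_{s}=n_{1}+\cdots+n_{t}$; it is denoted $D=[x_{j}(m_{j});y_{i}(n_{i})]_{s,t}$. Let $S(D)=\{x_1,\ldots,x_s\}\cup\{y_1,\ldots,y_t\}$. For $z\in S(D)$ put $\mathbf{m}(z)=\sum_{j:x_j=z}m_j$ and $\mathbf{n}(z)=\sum_{i:y_i=z}n_i$ (empty sums are $0$). $D$ is degenerate if $\mathbf{m}(z)=\mathbf{n}(z)$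 for all $z\in S(D)$. For a signed simplex $D$ in $L_p(\Omega,\mu)$, $\gamma_p(D)=\sum_{j,i} m_{j}n_{i}\|x_{j}-y_{i}\|_p^{p} - \sum_{j_{1} < j_{2}} m_{j_{1}}m_{j_{2}}\|x_{j_{1}}-x_{j_{2}}\|_p^{p} - \sum_{i_{1} < i_{2}} n_{i_{1}}n_{i_{2}}\|y_{i_{1}}-y_{i_{2}}\|_p^{p}$. A non-degenerate signed simplex $D$ in $L_p(\Omega,\mu)$ is virtually degenerate if for $\mu$-almost every $\omega\in\Omega$ the signed simplex $D(\omega)=[x_{j}(\omega)(m_{j});y_{i}(\omega)(n_{i})]_{s,t}$ in the scalar field is degenerate. *)

(* Defs.v *)
From HB Require Import structures.
From mathcomp Require Import all_boot all_order all_algebra.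
From mathcomp Require Import complex.
From mathcomp Require Import all_classical all_reals all_analysis.

Set Implicit Arguments.
Unset Strict Implicit.
Unset Printing Implicit Defensive.

Import Order.TTheory GRing.Theory Num.Theory.
Import numFieldNormedType.Exports.

Local Open Scope classical_set_scope.
Local Open Scope quotient_scope.
Local Open Scope ring_scope.

Record signed_simplex (R : realType) (X : Type) (s t : nat) := SignedSimplex {
  sx : 'I_s -> X;
  sy : 'I_t -> X;
  sm : 'I_s -> R;
  sn : 'I_t -> R;
  s_gt0 : (0 < s)%N;
  t_gt0 : (0 < t)%N;
  sum_weights : \sum_(j < s) sm j = \sum_(i < t) sn i }.

Definition map_simplex (R : realType) (X Y : Type) (s t : nat) (h : X -> Y)
    (D : signed_simplex R X s t) : signed_simplex R Y s t :=
  SignedSimplex (h \o sx D) (h \o sy D) (s_gt0 D) (t_gt0 D) (sum_weights D).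

Section degenerate.
Context (R : realType) (X : eqType) (s t : nat).
Implicit Type D : signed_simplex R X s t.

Definition vertices D : seq X := codom (sx D) ++ codom (sy D).

Definition mult_x D (z : X) : R := \sum_(j < s | sx D j == z) sm D j.
Definition mult_y D (z : X) : R := \sum_(i < t | sy D i == z) sn D i.

Definition degenerate D : Prop :=
  forall z, z \in vertices D -> mult_x D z = mult_y D z.

End degenerate.

Variant scalars := RealScalars | ComplexScalars.

Definition scalar_field (R : realType) (k : scalars) : numFieldType :=
  match k with RealScalars => R | ComplexScalars => R[i] end.

(* The norm that the numFieldType R[i] carries takes its values in R[i]; the
   modulus is wanted in R. *)
Definition modulus (R : realType) (k : scalars) : scalar_field R k -> R :=
  match k with
  | RealScalars => fun x : R => `|x|
  | ComplexScalars => fun z : R[i] => complex.Re `|z|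
  end.

Section Lp.
Context (d : measure_display) (T : measurableType d) (R : realType).
Variables (mu : {measure set T -> \bar R}) (p : R) (k : scalars).
Local Notation K := (scalar_field R k).

(* The library's Lspace covers real scalars and p >= 1 only, hence the
   construction below, which follows it. *)

Definition borel_measurable (f : T -> K) : Prop :=
  forall U : set K, open U -> measurable (f @^-1` U).

Definition Lp_fun : {pred T -> K} :=
  mem [set f | borel_measurable f /\ finite_norm mu p%:E (@modulus R k \o f)].

Definition Lp_funType : Type := {f : T -> K | f \in Lp_fun}.
HB.instance Definition _ := SubChoice.on Lp_funType.

Definition Lp_ae_eq (f g : Lp_funType) : bool :=
  `[< val f = val g %[ae mu] >].

Let Lp_ae_eq_refl : reflexive Lp_ae_eq.
Proof. by move=> f; apply/asboolP; apply: ae_eq_refl. Qed.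

Let Lp_ae_eq_sym : symmetric Lp_ae_eq.
Proof. by move=> f g; apply/asboolP/asboolP => /ae_eq_sym. Qed.

Let Lp_ae_eq_trans : transitive Lp_ae_eq.
Proof.
by move=> g f h /asboolP fg /asboolP gh; apply/asboolP; apply: ae_eq_trans gh.
Qed.

Canonical Lp_ae_eq_equiv :=
  EquivRel Lp_ae_eq Lp_ae_eq_refl Lp_ae_eq_sym Lp_ae_eq_trans.

Definition Lp : Type := {eq_quot Lp_ae_eq}.
HB.instance Definition _ := Choice.on Lp.
HB.instance Definition _ := EqQuotient.on Lp.

(* A chosen representative; the notions below depend on it only up to a
   mu-negligible set. *)
Definition Lp_repr (f : Lp) : T -> K := val (repr f).

Definition Lp_norm (f : T -> K) : R :=
  fine 'N[mu]_p%:E[EFin \o (@modulus R k \o f)]%E.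

(* a f + b g = 0 in Lp means that it vanishes almost everywhere. *)
Definition Lp_dim_ge2 : Prop :=
  exists f g : Lp, forall a b : K,
    {ae mu, forall w, a * Lp_repr f w + b * Lp_repr g w = 0} ->
    a = 0 /\ b = 0.

Section simplex.
Context (s t : nat).
Implicit Type D : signed_simplex R Lp s t.

(* || f - g ||_p ^ p *)
Definition Lp_distp (f g : Lp) : R := Lp_norm (Lp_repr f \- Lp_repr g) `^ p.

Definition gamma D : R :=
  \sum_(j < s) \sum_(i < t)
      sm D j * sn D i * Lp_distp (sx D j) (sy D i)
  - \sum_(j1 < s) \sum_(j2 < s | (j1 < j2)%N)
      sm D j1 * sm D j2 * Lp_distp (sx D j1) (sx D j2)
  - \sum_(i1 < t) \sum_(i2 < t | (i1 < i2)%N)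
      sn D i1 * sn D i2 * Lp_distp (sy D i1) (sy D i2).

Definition simplex_at D (w : T) : signed_simplex R K s t :=
  map_simplex (fun f : Lp => Lp_repr f w) D.

Definition virtually_degenerate D : Prop :=
  ~ degenerate D /\ {ae mu, forall w, degenerate (simplex_at D w)}.

End simplex.
End Lp.

(* Main.v *)
(* Fix z in Lp. For almost every w, degeneracy of D(w) makes the weights m and
   n agree on every scalar, so
     sum_j m_j |x_j(w) - z(w)|^p = sum_i n_i |y_i(w) - z(w)|^p,
   and integrating gives sum_j m_j ||x_j - z||^p = sum_i n_i ||y_i - z||^p.
   Taking z = x_k with weight m_k, resp. z = y_k with weight n_k, shows that
   the full double sums over pairs (x, x), (y, y) and (x, y) all coincide; by
   symmetry the first two are twice the sums over increasing index pairs. *)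
Require Import Defs.
From mathcomp Require Import all_boot all_order all_algebra.
From mathcomp Require Import complex lra.
From mathcomp Require Import all_classical all_reals all_analysis.
From mathcomp Require Import measurable_realfun.

Set Implicit Arguments.
Unset Strict Implicit.
Unset Printing Implicit Defensive.

Import Order.TTheory GRing.Theory Num.Theory.
Local Open Scope classical_set_scope.
Local Open Scope ring_scope.

(** * Real and complex scalars treated uniformly *)

Section scalars.
Import numFieldNormedType.Exports.
Context (R : realType) (k : scalars).
Local Notation K := (scalar_field R k).
Implicit Types x y : K.

(** Coordinates reduce measurability questions about [K]-valued functions to real-valued ones, for
    both fields at once. *)
Definition scalar_re : K -> R :=
  match k with RealScalars => id | ComplexScalars => @complex.Re R end.

Definition scalar_im : K -> R :=
  match k with RealScalars => fun=> 0 | ComplexScalars => @complex.Im R end.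

Lemma modulusE x :
  modulus x = Num.sqrt (scalar_re x ^+ 2 + scalar_im x ^+ 2).
Proof.
rewrite /scalar_re /scalar_im; case: k x => x /=.
  by rewrite expr0n addr0 sqrtr_sqr.
by rewrite -[LHS]/(complex.Re `|x : R[i]|) normc_def.
Qed.

Lemma scalar_reB x y : scalar_re (x - y) = scalar_re x - scalar_re y.
Proof. by rewrite /scalar_re; case: k x y => //= x y; rewrite raddfB. Qed.

Lemma scalar_imB x y : scalar_im (x - y) = scalar_im x - scalar_im y.
Proof.
by rewrite /scalar_im; case: k x y => /= x y; rewrite ?subr0 // raddfB.
Qed.

Lemma norm_scalar_re x : `|scalar_re x| <= modulus x.
Proof. by rewrite modulusE -sqrtr_sqr ler_wsqrtr// lerDl sqr_ge0. Qed.

Lemma norm_scalar_im x : `|scalar_im x| <= modulus x.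
Proof. by rewrite modulusE -sqrtr_sqr ler_wsqrtr// lerDr sqr_ge0. Qed.

Lemma modulus_ge0 x : 0 <= modulus x.
Proof. by rewrite modulusE sqrtr_ge0. Qed.

Lemma modulus0 : modulus (0 : K) = 0.
Proof. by rewrite /modulus; case: k; rewrite normr0. Qed.

Lemma distCmodulus x y : modulus (x - y) = modulus (y - x).
Proof. by rewrite /modulus; case: k x y => x y; rewrite distrC. Qed.

Lemma modulusB_le x y : modulus (x - y) <= modulus x + modulus y.
Proof.
rewrite /modulus; case: k x y => x y; first exact: ler_normB.
by have := ler_normB x y; rewrite lecE raddfD => /andP[].
Qed.

(** Balls of [K] have their radius in [K], so for complex scalars a real radius has to be embedded;
    a strict inequality in [R[i]] then yields one between real parts. *)
Lemma modulus_small (e : R) : 0 < e ->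
  exists2 e' : K, 0 < e' & forall x, `|x| < e' -> modulus x < e.
Proof.
rewrite /modulus; case: k => e0; first by exists e.
by exists e%:C%C; [rewrite ltcR | move=> x; rewrite ltcE => /andP[]].
Qed.

Lemma open_nonexpansive_gt (u : K -> R) (a : R) :
  (forall x y, `|u x - u y| <= modulus (x - y)) -> open [set x | a < u x].
Proof.
move=> u1; rewrite openE => x /= ax.
(* Moving by less than [u x - a] in modulus keeps [u] above [a]. *)
have [e e0 he] : exists2 e : K, 0 < e &
    forall y, `|y| < e -> modulus y < u x - a.
  by apply: modulus_small; rewrite subr_gt0.
apply/nbhs_ballP; exists e => // y; rewrite -ball_normE /= => /he xy.
by have := le_lt_trans (u1 x y) xy; rewrite ltr_norml => /andP[]; lra.
Qed.

End scalars.

(** The sum is at most twice the larger term. This avoids convexity, hence covers p < 1 as well. *)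
Lemma powR_add_le (R : realType) (p a b : R) : 0 < p ->
  0 <= a -> 0 <= b ->
  (a + b) `^ p <= 2 `^ p * (a `^ p + b `^ p).
Proof.
move=> p0.
wlog ab : a b / a <= b => [wl a0 b0|a0 b0].
  have [/wl->//|/ltW ba] := leP a b.
  by rewrite addrC (addrC (a `^ p)) wl.
apply: (@le_trans _ _ ((2 * b) `^ p)).
  by apply: ge0_ler_powR; rewrite ?nnegrE ?(ltW p0)//; lra.
by rewrite powRM// ler_wpM2l ?powR_ge0// lerDr powR_ge0.
Qed.

(** * Measurability and integrability of p-th powers of distances *)

Section Lp_integrals.
Context (d : measure_display) (T : measurableType d) (R : realType).
Context (mu : {measure set T -> \bar R}) (p : R) (k : scalars).
Local Notation K := (scalar_field R k).
Implicit Types f g : T -> K.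

(** Open rays generate the Borel sets of [R], and their preimages under [u] are open in [K]. *)
Lemma borel_measurable_nonexpansive (u : K -> R) f :
  (forall x y, `|u x - u y| <= modulus (x - y)) ->
  borel_measurable f -> measurable_fun setT (u \o f).
Proof.
move=> u1 mf; apply: (measurability _ (RGenOInfty.measurableE R)).
move=> _ [_ [a ->] <-]; rewrite setTI.
rewrite (_ : _ @^-1` _ = f @^-1` [set x | a < u x]); last first.
  by apply/seteqP; split => w /=; rewrite in_itv/= andbT.
exact/mf/open_nonexpansive_gt.
Qed.

(** The subtraction is carried out on real and imaginary parts, which are nonexpansive; the modulus
    is the square root of the sum of the squared differences. *)
Lemma measurable_modulusB f g : borel_measurable f -> borel_measurable g ->
  measurable_fun setT (fun w => modulus (f w - g w)).
Proof.
move=> mf mg.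
have mre (h : T -> K) : borel_measurable h ->
    measurable_fun setT (@scalar_re R k \o h).
  move=> mh; apply: (borel_measurable_nonexpansive _ mh) => x y.
  by rewrite -scalar_reB norm_scalar_re.
have mim (h : T -> K) : borel_measurable h ->
    measurable_fun setT (@scalar_im R k \o h).
  move=> mh; apply: (borel_measurable_nonexpansive _ mh) => x y.
  by rewrite -scalar_imB norm_scalar_im.
under eq_fun do rewrite modulusE scalar_reB scalar_imB.
have msqrt : measurable_fun setT (@Num.sqrt R).
  by apply: continuous_measurable_fun; exact: sqrt_continuous.
apply: (measurableT_comp msqrt); apply: measurable_funD;
  apply: measurable_funX; apply: measurable_funB.
- exact: mre mf.
- exact: mre mg.
- exact: mim mf.
- exact: mim mg.
Qed.

Hypothesis p0 : 0 < p.

Lemma Lnorm_powRE (h : T -> R) :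
  ('N[mu]_p%:E[EFin \o h] `^ p = \int[mu]_w (`|h w| `^ p)%:E)%E.
Proof. by rewrite poweR_Lnorm ?gt_eqF. Qed.

(** Domination of |f - g|^p by 2^p (|f|^p + |g|^p). *)
Lemma integrable_distp f g :
  f \in Lp_fun (k := k) mu p -> g \in Lp_fun (k := k) mu p ->
  mu.-integrable setT (EFin \o (fun w => modulus (f w - g w) `^ p)).
Proof.
rewrite !inE => -[mf ff] [mg fg].
have mpow (h : T -> R) : measurable_fun setT h ->
    measurable_fun setT (EFin \o (fun w : T => h w `^ p)).
  move=> mh; apply/measurable_EFinP.
  exact: (measurableT_comp (measurable_powR p)).
have m1 (h : T -> K) : borel_measurable h ->
    measurable_fun setT (fun w => modulus (h w)).
  move=> mh; apply: (borel_measurable_nonexpansive _ mh) => x y.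
  (* The two bounds come from x = (x - y) - (- y) and - y = (x - y) - x; that - y and y have the
     same modulus is [distCmodulus] at 0. *)
  rewrite ler_norml; have := modulusB_le (x - y) (- y).
  have := modulusB_le (x - y) x; rewrite opprK subrK.
  rewrite addrAC subrr sub0r -(sub0r y) distCmodulus subr0; lra.
have int1 (h : T -> K) : borel_measurable h ->
    finite_norm mu p%:E (@modulus R k \o h) ->
    mu.-integrable setT (EFin \o (fun w => modulus (h w) `^ p)).
  move=> mh fh; apply/integrableP; split; first exact/mpow/m1.
  under eq_integral => w _ do
    rewrite /= ger0_norm ?powR_ge0// -(ger0_norm (modulus_ge0 (h w))).
  by rewrite -(Lnorm_powRE (@modulus R k \o h)) poweR_lty.
apply: (@le_integrable _ _ _ _ _ _ _
  (EFin \o (fun w => 2 `^ p * (modulus (f w) `^ p + modulus (g w) `^ p)))).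
- exact: measurableT.
- exact/mpow/measurable_modulusB.
- move=> w _ /=; rewrite lee_fin ger0_norm ?powR_ge0//.
  apply: le_trans (ler_norm _).
  apply: (le_trans _ (powR_add_le p0 (modulus_ge0 _) (modulus_ge0 _))).
  apply: ge0_ler_powR; rewrite ?nnegrE ?addr_ge0 ?modulus_ge0 ?(ltW p0)//.
  exact: modulusB_le.
- apply: (@integrableZl _ _ _ _ _ measurableT (2 `^ p)
    (fun w => (modulus (f w) `^ p)%:E + (modulus (g w) `^ p)%:E)%E).
  by apply: integrableD => //; exact: int1.
Qed.

Lemma Lp_distpE (f g : Lp mu p k) : Lp_distp f g =
  \int[mu]_w (modulus (Lp_repr f w - Lp_repr g w) `^ p).
Proof.
rewrite /Lp_distp /Lp_norm -fine_poweR Lnorm_powRE /Rintegral.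
congr fine; apply: eq_integral => w _.
by rewrite /= ger0_norm ?modulus_ge0.
Qed.

Lemma Lp_distpC (f g : Lp mu p k) : Lp_distp f g = Lp_distp g f.
Proof.
by rewrite !Lp_distpE; apply: eq_Rintegral => w _; rewrite distCmodulus.
Qed.

Lemma Lp_distpp (f : Lp mu p k) : Lp_distp f f = 0.
Proof.
(* The integrand is 0 to the power p, which is 0 because p is nonzero. *)
rewrite Lp_distpE; under eq_Rintegral do
  rewrite subrr modulus0 powR0 ?gt_eqF//.
by rewrite Rintegral_cst// mul0r.
Qed.

(** Integrability is part of the induction because additivity of the real-valued integral requires
    it of the tail sum. *)
Lemma Rintegral_sumZ (n : nat) (c : 'I_n -> R) (h : 'I_n -> T -> R) :
  (forall j, mu.-integrable setT (EFin \o h j)) ->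
  mu.-integrable setT (EFin \o (fun w => \sum_(j < n) c j * h j w)) /\
  \int[mu]_w (\sum_(j < n) c j * h j w) = \sum_(j < n) c j * \int[mu]_w h j w.
Proof.
elim: n c h => [|n IH] c h ih.
  split; last by under eq_Rintegral do rewrite big_ord0;
    rewrite Rintegral_cst// mul0r big_ord0.
  under [X in _ \o X]eq_fun do rewrite big_ord0.
  exact: integrable0.
have [ihS IHS] := IH (c \o lift ord0) _ (fun j => ih (lift ord0 j)).
have i0 : mu.-integrable setT (EFin \o (fun w => c ord0 * h ord0 w)).
  exact: (@integrableZl _ _ _ _ _ measurableT (c ord0) (EFin \o h ord0)).
split.
  under [X in _ \o X]eq_fun do rewrite big_ord_recl.
  exact: (@integrableD _ _ _ _ _ measurableT _ _ i0 ihS).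
under eq_Rintegral do rewrite big_ord_recl.
by rewrite RintegralD// RintegralZl// IHS big_ord_recl.
Qed.

End Lp_integrals.

(** * Finite weighted sums over the vertices of a simplex *)

Lemma degenerate_sum (R : realType) (X : eqType) (s t : nat)
    (D : signed_simplex R X s t) (F : X -> R) : degenerate D ->
  \sum_(j < s) sm D j * F (sx D j) = \sum_(i < t) sn D i * F (sy D i).
Proof.
(* Both sums are regrouped by the distinct vertices z, where degeneracy equates the coefficients of
   F z. *)
move=> degD; set V := undup (vertices D).
have xV j : sx D j \in V.
  by rewrite mem_undup mem_cat codom_f.
have yV i : sy D i \in V.
  by rewrite mem_undup mem_cat codom_f orbT.
have group (n : nat) (c : 'I_n -> R) (x : 'I_n -> X) :
    (forall j, x j \in V) ->
    \sum_(j < n) c j * F (x j)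
    = \sum_(z <- V) (\sum_(j < n | x j == z) c j) * F z.
  move=> xinV; under [RHS]eq_bigr do rewrite mulr_suml.
  rewrite (exchange_big_dep xpredT)//=; apply: eq_bigr => j _.
  (* Index j contributes only at z = x j, which occurs exactly once in the duplicate-free [V]. *)
  rewrite (big_rem (x j))//= eqxx big_seq_cond big1 ?addr0// => z.
  by rewrite mem_rem_uniq ?undup_uniq// inE eq_sym => /andP[/andP[/negPf->]].
rewrite (group _ _ (sx D))// (group _ _ (sy D))//.
rewrite big_seq [RHS]big_seq; apply: eq_bigr => z.
by rewrite mem_undup => /degD; rewrite /mult_x /mult_y => ->.
Qed.

Lemma sum_sym_lt (R : realType) (n : nat) (A : 'I_n -> 'I_n -> R) :
  (forall i j, A i j = A j i) -> (forall i, A i i = 0) ->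
  \sum_(i < n) \sum_(j < n) A i j
  = 2 * \sum_(i < n) \sum_(j < n | (i < j)%N) A i j.
Proof.
move=> symA diagA.
have -> : \sum_(i < n) \sum_(j < n) A i j =
    \sum_(i < n) (\sum_(j < n | (i < j)%N) A i j +
                  \sum_(j < n | (j < i)%N) A i j).
  apply: eq_bigr => i _; rewrite (bigID (fun j : 'I_n => (i < j)%N))/=.
  congr (_ + _); rewrite (bigD1 i) ?ltnn//= diagA add0r.
  by apply: eq_bigl => j; rewrite -leqNgt andbC ltn_neqAle.
(* Exchanging the sums turns the lower triangle into the upper one, up to the symmetry of [A]. *)
rewrite big_split/= [X in _ + X](exchange_big_dep xpredT)//= mulr_natl mulr2n.
by congr (_ + _); apply: eq_bigr => i _; apply: eq_bigr => j _.
Qed.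

Lemma balanced_simplex_sum (R : realType) (X : Type) (s t : nat)
    (D : signed_simplex R X s t) (dist : X -> X -> R) :
  (forall x y, dist x y = dist y x) -> (forall x, dist x x = 0) ->
  (forall z, \sum_(j < s) sm D j * dist (sx D j) z
           = \sum_(i < t) sn D i * dist (sy D i) z) ->
  \sum_(j1 < s) \sum_(j2 < s | (j1 < j2)%N)
      sm D j1 * sm D j2 * dist (sx D j1) (sx D j2)
  + \sum_(i1 < t) \sum_(i2 < t | (i1 < i2)%N)
      sn D i1 * sn D i2 * dist (sy D i1) (sy D i2)
  = \sum_(j < s) \sum_(i < t) sm D j * sn D i * dist (sx D j) (sy D i).
Proof.
move=> dC d0 bal.
set Sx := (X in X + _ = _); set Sy := (X in _ + X = _); set Sxy := RHS.
(* Balance at z = x_j, weighted by m_j and summed over j. *)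
have Ex : 2 * Sx = Sxy.
  rewrite /Sx -sum_sym_lt; last 2 first.
  - by move=> i j; rewrite dC (mulrC (sm D i)).
  - by move=> i; rewrite d0 mulr0.
  apply: eq_bigr => j _.
  under [LHS]eq_bigr do rewrite -mulrA dC.
  under [RHS]eq_bigr do rewrite -mulrA dC.
  by rewrite -!mulr_sumr bal.
(* Likewise with z = y_i and weight n_i, after exchanging the sums in [Sxy]. *)
have Ey : 2 * Sy = Sxy.
  rewrite /Sy -sum_sym_lt; last 2 first.
  - by move=> i j; rewrite dC (mulrC (sn D i)).
  - by move=> i; rewrite d0 mulr0.
  rewrite /Sxy [RHS]exchange_big; apply: eq_bigr => i _.
  under [LHS]eq_bigr do rewrite -mulrA dC.
  under [RHS]eq_bigr do rewrite (mulrC (sm D _)) -mulrA.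
  by rewrite -!mulr_sumr bal.
lra.
Qed.

(** * Integrating the pointwise identity, and conclusion *)

Lemma virtually_degenerate_balanced (R : realType) (k : scalars) (p : R)
    (d : measure_display) (T : measurableType d)
    (mu : {measure set T -> \bar R}) (s t : nat)
    (D : signed_simplex R (Lp mu p k) s t) (z : Lp mu p k) : 0 < p ->
  virtually_degenerate D ->
  \sum_(j < s) sm D j * Lp_distp (sx D j) z
  = \sum_(i < t) sn D i * Lp_distp (sy D i) z.
Proof.
move=> p0 [_ degD].
have int (f : Lp mu p k) : mu.-integrable setT
    (EFin \o (fun w => modulus (Lp_repr f w - Lp_repr z w) `^ p)).
  exact: (integrable_distp p0 (valP (repr f)) (valP (repr z))).
have [ix Ix] := Rintegral_sumZ (sm D) (fun j => int (sx D j)).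
have [iy Iy] := Rintegral_sumZ (sn D) (fun i => int (sy D i)).
under eq_bigr do rewrite Lp_distpE//.
under [RHS]eq_bigr do rewrite Lp_distpE//.
rewrite -Ix -Iy /Rintegral; congr fine; apply: ae_eq_integral => //.
- exact: measurable_int ix.
- exact: measurable_int iy.
(* At almost every w the integrands agree, by regrouping with F(c) = |c - z(w)|^p in the scalar
   field. *)
apply: filterS degD => w degDw _ /=; congr EFin.
exact: (degenerate_sum
  (fun c => modulus (c - Lp_repr z w) `^ p) degDw).
Qed.

Theorem lemma4p5 (R : realType) (k : scalars) (p : R) (hp : 0 < p)
  (d : measure_display) (T : measurableType d)
  (mu : {measure set T -> \bar R}) (mu_nontrivial : mu setT <> 0%E)
  (dim_ge2 : Lp_dim_ge2 mu p k)
  (s t : nat) (D : signed_simplex R (Lp mu p k) s t) :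
  virtually_degenerate D ->
  gamma D = 0 /\
  \sum_(j1 < s) \sum_(j2 < s | (j1 < j2)%N)
      sm D j1 * sm D j2 * Lp_distp (sx D j1) (sx D j2)
  + \sum_(i1 < t) \sum_(i2 < t | (i1 < i2)%N)
      sn D i1 * sn D i2 * Lp_distp (sy D i1) (sy D i2)
  = \sum_(j < s) \sum_(i < t)
      sm D j * sn D i * Lp_distp (sx D j) (sy D i).
Proof.
move=> vdD; have eqD := balanced_simplex_sum
  (@Lp_distpC _ _ _ mu p k hp) (@Lp_distpp _ _ _ mu p k hp)
  (fun z => virtually_degenerate_balanced z hp vdD).
by split=> //; rewrite /gamma -eqD addrAC addrK subrr.
Qed.
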